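(* Let Alice and Bob hold systems of equal dimension $d$. Let $T_{jkl}$ be a thermal tensor, $\sum_lT_{jkl}\gamma_l=\gamma_j$ for all $j,k$, having an identity as at least one layer, i.e. $T_{jkl_0}=\delta_{j,k}$ for some $l_0$ [or, in the infinite-temperature case where all Gibbs vectors are uniform, a permutation matrix: $T_{jkl_0}=\delta_{j,\sigma(k)}$ for some $l_0$ and some permutation $\sigma$]. Then for every probability vector $\mathbf p$ and the sharp state $q_l=\delta_{l,l_0}$, the uncorrelated pair $\mathbf p\otimes\mathbf q$ can be mapped into a maximally correlated state by a one-round LTOCC.
   Context: States are energy-incoherent, i.e. probability vectors. $\gamma$ is Bob's Gibbs vector (strictly positive entries); a thermal tensor is moreover stochastic: $T_{jkl}\ge0$ and $\sum_jT_{jkl}=1$ for all $k,l$. Index $k$ is Alice's input, $l$ Bob's input, $i,j$ Alice's and Bob's outputs. A one-round LTOCC (with measurement by Alice) is a stochastic matrix $M_{ij,kl}=\Lambda_{ik}T_{jkl}$ with $\Lambda$ a stochastic matrix preserving Alice's Gibbs vector and $T$ a thermal tensor for Bob; the output joint distribution is $\pi_{ij}=\sum_{kl}M_{ij,kl}p_kq_l$. A joint distribution $\pi$ is maximally correlated if each party's outcome determines the other's, i.e. the conditional entropies vanish: $H(A|B)=H(B|A)=0$. *)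

(* Defs.v *)
From HB Require Import structures.
From mathcomp Require Import all_boot all_order all_fingroup all_algebra.
From mathcomp Require Import reals exp.

Set Implicit Arguments.
Unset Strict Implicit.
Unset Printing Implicit Defensive.

Import Order.TTheory GRing.Theory Num.Theory.
Local Open Scope ring_scope.

Definition prob_dist (R : realType) (I : finType) (p : I -> R) : Prop :=
  (forall i, 0 <= p i) /\ \sum_i p i = 1.

Definition prob_vector (R : realType) (d : nat) (p : 'cV[R]_d) : Prop :=
  prob_dist (fun i => p i 0).

Definition gibbs_vector (R : realType) (d : nat) (g : 'cV[R]_d) : Prop :=
  prob_vector g /\ (forall i, 0 < g i 0).

Definition uniform_vector (R : realType) (d : nat) : 'cV[R]_d :=
  const_mx (d%:R^-1).

(* Column-stochastic: the first argument is the output, the second the input,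
   and each input yields a probability distribution over outputs. *)
Definition stochastic (R : realType) (O I : finType) (M : O -> I -> R) : Prop :=
  forall k, prob_dist (fun i => M i k).

Definition gibbs_stochastic (R : realType) (d : nat) (g : 'cV[R]_d)
    (L : 'M[R]_d) : Prop :=
  stochastic (fun i k => L i k) /\ L *m g = g.

(* [T j k l]: [j] is Bob's output, [k] Alice's input, [l] Bob's input. *)
Definition thermal_tensor (R : realType) (d : nat) (g : 'cV[R]_d)
    (T : 'I_d -> 'I_d -> 'I_d -> R) : Prop :=
  stochastic (fun j (kl : 'I_d * 'I_d) => T j kl.1 kl.2) /\
  (forall j k, \sum_l T j k l * g l 0 = g j 0).

(* [M (i, j) (k, l)]: [i], [j] are the outputs and [k], [l] the inputs of Alice
   and Bob respectively.  Bob's thermal tensor is kept as a parameter so that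
   one can speak of the one-round LTOCCs realised with a given tensor. *)
Definition one_round_LTOCC (R : realType) (d : nat) (gA gB : 'cV[R]_d)
    (T : 'I_d -> 'I_d -> 'I_d -> R)
    (M : 'I_d * 'I_d -> 'I_d * 'I_d -> R) : Prop :=
  [/\ stochastic M,
      thermal_tensor gB T &
      exists L : 'M[R]_d,
        gibbs_stochastic gA L /\
        (forall i j k l, M (i, j) (k, l) = L i k * T j k l)].

Definition output_state (R : realType) (d : nat)
    (M : 'I_d * 'I_d -> 'I_d * 'I_d -> R) (p q : 'cV[R]_d) : 'M[R]_d :=
  \matrix_(i, j) \sum_k \sum_l M (i, j) (k, l) * (p k 0 * q l 0).

Definition margA (R : realType) (d : nat) (w : 'M[R]_d) (i : 'I_d) : R :=
  \sum_j w i j.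

Definition margB (R : realType) (d : nat) (w : 'M[R]_d) (j : 'I_d) : R :=
  \sum_i w i j.

(* Shannon conditional entropies in nats.  The convention 0 log 0 = 0 holds
   because a term with [w i j = 0] has a zero factor; for a joint distribution
   a vanishing marginal forces [w i j = 0]. *)
Definition cond_entropy_AB (R : realType) (d : nat) (w : 'M[R]_d) : R :=
  - \sum_i \sum_j w i j * ln (w i j / margB w j).

Definition cond_entropy_BA (R : realType) (d : nat) (w : 'M[R]_d) : R :=
  - \sum_i \sum_j w i j * ln (w i j / margA w i).

Definition maximally_correlated (R : realType) (d : nat) (w : 'M[R]_d) : Prop :=
  [/\ prob_dist (fun ij : 'I_d * 'I_d => w ij.1 ij.2),
      cond_entropy_AB w = 0 &
      cond_entropy_BA w = 0].

(* Main.v *)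
(** Alice does nothing: for [L = 1] and Bob's sharp input [l0], the output is
    [w i j = [j = s i] * p i], with [s] the permutation of the layer [l0].  It is
    supported on the graph of a bijection, so each outcome determines the other. *)
Require Import Defs.
From HB Require Import structures.
From mathcomp Require Import all_boot all_order all_fingroup all_algebra.
From mathcomp Require Import reals exp.

Set Implicit Arguments.
Unset Strict Implicit.
Unset Printing Implicit Defensive.

Import Order.TTheory GRing.Theory Num.Theory.
Local Open Scope ring_scope.

Lemma gibbs_stochastic1 (R : realType) (d : nat) (g : 'cV[R]_d) :
  gibbs_stochastic g 1%:M.
Proof.
split; last exact: mul1mx.
move=> k; split=> [i|]; first by rewrite mxE ler0n.
by rewrite (bigD1 k) //= mxE eqxx big1 ?addr0 // => i /negPf ik; rewrite mxE ik.
Qed.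

(** Summing over Bob's output first turns each tensor column into the factor 1 and leaves a column
    sum of [L]. *)
Lemma stochastic_LTOCC (R : realType) (d : nat) (L : 'M[R]_d)
    (T : 'I_d -> 'I_d -> 'I_d -> R) :
  stochastic (fun i k => L i k) ->
  stochastic (fun j (kl : 'I_d * 'I_d) => T j kl.1 kl.2) ->
  stochastic (fun ij kl : 'I_d * 'I_d => L ij.1 kl.1 * T ij.2 kl.1 kl.2).
Proof.
move=> hL hT [k l]; have [L0 L1] := hL k; have [T0 T1] := hT (k, l).
split=> [[i j]|] /=; first by rewrite mulr_ge0 ?L0 ?T0.
rewrite -(pair_bigA _ (fun i j => L i k * T j k l)) /= -[RHS]L1.
by apply: eq_bigr => i _; rewrite -mulr_sumr T1 mulr1.
Qed.

Section PermutedDiagonal.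
Variables (R : realType) (d : nat) (p : 'cV[R]_d) (s : 'S_d).

Let w : 'M[R]_d := \matrix_(i, j) ((j == s i)%:R * p i 0).

Lemma margA_perm i : margA w i = p i 0.
Proof.
rewrite /margA (bigD1 (s i)) //= mxE eqxx mul1r big1 ?addr0 // => j /negPf ji.
by rewrite mxE ji mul0r.
Qed.

(** Injectivity of [s] makes row [i] the only one that can contribute to column [s i]; this is what
    lets Bob's outcome determine Alice's. *)
Lemma margB_perm i : margB w (s i) = p i 0.
Proof.
rewrite /margB (bigD1 i) //= mxE eqxx mul1r big1 ?addr0 // => k ki.
by rewrite mxE (inj_eq perm_inj) eq_sym (negPf ki) mul0r.
Qed.

(** The shape of an entropy term whose entry equals its marginal. At [x = 0] the outer factor kills
    the term, so [p] may have zero entries. *)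
Lemma mulr_ln_self (x : R) : x * ln (x / x) = 0.
Proof. by have [->|x0] := eqVneq x 0; rewrite ?mul0r // divff // ln1 mulr0. Qed.

(** Both entropies vanish term by term: off the graph of [s] the entry is 0, and on it the entry
    equals both marginals, so the conditional probability is 1 wherever [p] is nonzero. *)
Lemma perm_maximally_correlated :
  prob_vector p -> maximally_correlated w.
Proof.
move=> [p0 p1]; split.
- split=> [[i j]|]; first by rewrite mxE mulr_ge0 ?ler0n ?p0.
  rewrite -(pair_bigA _ (fun i j => w i j)) /= -[RHS]p1.
  by apply: eq_bigr => i _; exact: margA_perm.
- apply/eqP; rewrite oppr_eq0; apply/eqP.
  apply: big1 => i _; apply: big1 => j _; rewrite mxE.
  by case: eqP => [->|_]; rewrite ?mul0r // mul1r margB_perm mulr_ln_self.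
- apply/eqP; rewrite oppr_eq0; apply/eqP.
  apply: big1 => i _; apply: big1 => j _; rewrite mxE.
  by case: eqP => [_|_]; rewrite ?mul0r // mul1r margA_perm mulr_ln_self.
Qed.

End PermutedDiagonal.

Theorem mainTheorem12 (R : realType) (d : nat) (gA gB : 'cV[R]_d)
    (T : 'I_d -> 'I_d -> 'I_d -> R) (l0 : 'I_d)
    (hgA : gibbs_vector gA) (hgB : gibbs_vector gB)
    (hT : thermal_tensor gB T)
    (hlayer :
      (forall j k, T j k l0 = (j == k)%:R) \/
      [/\ gA = uniform_vector R d, gB = uniform_vector R d &
          exists s : 'S_d, forall j k, T j k l0 = (j == s k)%:R]) :
  forall p q : 'cV[R]_d,
    prob_vector p ->
    (forall l, q l 0 = (l == l0)%:R) ->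
    exists M : 'I_d * 'I_d -> 'I_d * 'I_d -> R,
      one_round_LTOCC gA gB T M /\ maximally_correlated (output_state M p q).
Proof.
move=> p q hp hq.
(* The identity layer is the permutation layer of [1%g], so both alternatives are treated at
   once. *)
have [s hs] : exists s : 'S_d, forall j k, T j k l0 = (j == s k)%:R.
  case: hlayer => [hid|[_ _ //]].
  by exists 1%g => j k; rewrite perm1 hid.
pose L : 'M[R]_d := 1%:M.
have [hL hLg] := gibbs_stochastic1 gA.
exists (fun ij kl => L ij.1 kl.1 * T ij.2 kl.1 kl.2); split.
  split=> //; first by apply: stochastic_LTOCC => //; case: hT.
  by exists L.
suff -> : output_state (fun ij kl => L ij.1 kl.1 * T ij.2 kl.1 kl.2) p q =
          \matrix_(i, j) ((j == s i)%:R * p i 0).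
  exact: perm_maximally_correlated.
(* Of the double sum over inputs only one term survives: [L = 1] forces [k = i], and the sharp [q]
   forces [l = l0]. *)
apply/matrixP => i j; rewrite !mxE (bigD1 i) //= [X in _ + X]big1 ?addr0.
  rewrite (bigD1 l0) //= big1 ?addr0 => [|l /negPf ll0]; last first.
    by rewrite hq ll0 !mulr0.
  by rewrite mxE eqxx mul1r hs hq eqxx mulr1.
move=> k /negPf ki; apply: big1 => l _.
by rewrite mxE eq_sym ki !mul0r.
Qed.
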